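(* Let $\{(x_{i,k},y_{i,k})\}$ be a sequence generated by Algorithm rPF-AGP-NSC (described in the context) applied to the nonconvex-strongly concave problem $\min_{x\in\mathcal X}\max_{y\in\mathcal Y}f(x,y)$, where $f$ has Lipschitz continuous gradients with constants $L_{11},L_{12},L_{22}$ as in the context, $L=\max\{L_{11},L_{12},L_{22}\}$, and $f(x,\cdot)$ is $\mu$-strongly concave for every $x\in\mathcal X$. Let $\eta_i=\frac{(2\beta_i+\mu)(\beta_i+L)}{\mu\beta_i}$. If $$\beta_i>\frac{3L}2,\qquad \alpha_i>\frac{L(L+\beta_i)^2\eta_i^2}{\beta_i^2}+\frac{L^2}\mu+\frac{3L}2,$$ then for all $\varepsilon>0$, $$T_i(\varepsilon)\le\frac{d_2^i}{\varepsilon^2d_1^i},$$ where $T_i(\varepsilon)=\min\{k\mid\|\nabla G(x_{i,k},y_{i,k})\|\le\varepsilon\}$ with $\nabla G$ the stationarity gap defined in the context, $$d_1^i=\min\left\{\frac{\alpha_i-\frac{L(L+\beta_i)^2\eta_i^2}{\beta_i^2}-\frac{L^2}\mu-\frac{3L}2}{2\alpha_i^2},\ \frac{\beta_i-\frac{3L}2}{\beta_i^2+2L^2}\right\},\qquad d_2^i=S(x_{i,1},y_{i,1})-\underline S,$$ $S(x,y)=2\Phi(x)-f(x,y)$, $\Phi(x)=\max_{y\in\mathcal Y}f(x,y)$, and $\underline S=\min_{x\in\mathcal X}\max_{y\in\mathcal Y}f(x,y)$.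
   Context: Setting: $\mathcal X\subseteq\mathbb R^n$ and $\mathcal Y\subseteq\mathbb R^m$ are nonempty compact convex sets, $f:\mathcal X\times\mathcal Y\to\mathbb R$ is smooth (continuously differentiable), $\|\cdot\|$ is the Euclidean norm, and $\mathcal P_{\mathcal X},\mathcal P_{\mathcal Y}$ are the Euclidean projections. $f$ is possibly nonconvex in $x$, and for each $x\in\mathcal X$, $f(x,\cdot)$ is $\mu$-strongly concave ($\mu>0$) on $\mathcal Y$: $f(x,y')\le f(x,y)+\langle\nabla_yf(x,y),y'-y\rangle-\frac\mu2\|y'-y\|^2$. Lipschitz gradients: there are positive scalars $L_{11},L_{12},L_{22}$ such that for all $x,\tilde x\in\mathcal X$, $y,\tilde y\in\mathcal Y$: $\|\nabla_xf(x,y)-\nabla_xf(\tilde x,y)\|\le L_{11}\|x-\tilde x\|$, $\|\nabla_yf(x,y)-\nabla_yf(\tilde x,y)\|\le L_{12}\|x-\tilde x\|$, $\|\nabla_yf(x,\tilde y)-\nabla_yf(x,y)\|\le L_{22}\|\tilde y-y\|$. Algorithm rPF-AGP-NSC. Input $x_{1,1}\in\mathcal X$, $y_{1,1}\in\mathcal Y$, $l_1>0$, $\mu$, the accuracy $\varepsilon$, and $\underline S$. For each outer index $i\ge1$ put $\beta_i=3l_i$, $\alpha_i=\frac{158l_i^3}{\mu^2}$ and run, for $k=1,2,\dots$, the inner iteration $$y_{i,k+1}=\mathcal P_{\mathcal Y}\Big(y_{i,k}+\tfrac1{\beta_i}\nabla_yf(x_{i,k},y_{i,k})\Big),\qquad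 x_{i,k+1}=\mathcal P_{\mathcal X}\Big(x_{i,k}-\tfrac1{\alpha_i}\nabla_xf(x_{i,k},y_{i,k+1})\Big).$$ The algorithm runs the inner iteration for a prescribed number of steps; if the resulting point is not $\varepsilon$-stationary it restarts with $x_{i+1,1}=x_{1,1}$, $y_{i+1,1}=y_{1,1}$, $l_{i+1}=2l_i$. For the statement, the inner recursion for index $i$ is regarded as defining $(x_{i,k},y_{i,k})$ for all $k\ge1$. Stationarity gap: $\nabla G(x_{i,k},y_{i,k})$ is the vector with blocks $\alpha_i\big(x_{i,k}-\mathcal P_{\mathcal X}(x_{i,k}-\frac1{\alpha_i}\nabla_xf(x_{i,k},y_{i,k}))\big)$ and $\beta_i\big(y_{i,k}-\mathcal P_{\mathcal Y}(y_{i,k}+\frac1{\beta_i}\nabla_yf(x_{i,k},y_{i,k}))\big)$.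
   Formalization: T_i(ε) is counted with k starting from 0 at the initial point (x_{i,1},y_{i,1}), so the bound proved is on T_i(ε)−1 in the printed indexing; as printed the claim fails, e.g. for singleton X, Y and f=0, where d_2=0 but T_i=1. *)

(* Defs.v *)
From HB Require Import structures.
From mathcomp Require Import all_boot all_order all_algebra.
From mathcomp Require Import all_classical all_reals all_analysis.

Set Implicit Arguments.
Unset Strict Implicit.
Unset Printing Implicit Defensive.

Import Order.TTheory GRing.Theory Num.Theory.
Import numFieldNormedType.Exports.

Local Open Scope classical_set_scope.
Local Open Scope ring_scope.

(* The library's norm `|u| on row vectors is the sup norm, hence the explicit
   Euclidean inner product and norm; the two norms define the same topology,
   so library notions such as [compact] and [differentiable] are used as is. *)
Definition dot (R : realType) (p : nat) (u v : 'rV[R]_p) : R :=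
  \sum_(j < p) u 0 j * v 0 j.

Definition enorm (R : realType) (p : nat) (u : 'rV[R]_p) : R :=
  Num.sqrt (dot u u).

(* Euclidean projection. For C nonempty, closed and convex, the set below is a
   singleton; the default value 0 of [xget] is then irrelevant. *)
Definition proj (R : realType) (p : nat) (C : set 'rV[R]_p) (u : 'rV[R]_p) :
    'rV[R]_p :=
  xget 0 [set c | C c /\ forall c', C c' -> enorm (u - c) <= enorm (u - c')].

Definition grad (R : realType) (p : nat) (g : 'rV[R]_p -> R) (u : 'rV[R]_p) :
    'rV[R]_p :=
  \row_(j < p) ('D_(delta_mx 0 j) g u).

Definition grad_x (R : realType) (n m : nat) (f : 'rV[R]_n -> 'rV[R]_m -> R)
    (x : 'rV[R]_n) (y : 'rV[R]_m) : 'rV[R]_n :=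
  grad (fun x' => f x' y) x.

Definition grad_y (R : realType) (n m : nat) (f : 'rV[R]_n -> 'rV[R]_m -> R)
    (x : 'rV[R]_n) (y : 'rV[R]_m) : 'rV[R]_m :=
  grad (f x) y.

(* f is a total function, of which only the values near X x Y matter: the
   differentiability below is that of f as a function on R^n x R^m. It holds
   in particular if f is C^1 on an open set containing X x Y. *)
Definition smooth_on (R : realType) (n m : nat)
    (X : set 'rV[R]_n) (Y : set 'rV[R]_m)
    (f : 'rV[R]_n -> 'rV[R]_m -> R) : Prop :=
  [/\ forall x y, X x -> Y y ->
        differentiable (fun z : 'rV[R]_n * 'rV[R]_m => f z.1 z.2) (x, y),
      {within X `*` Y, continuous (fun z => grad_x f z.1 z.2)} &
      {within X `*` Y, continuous (fun z => grad_y f z.1 z.2)}].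

Definition strongly_concave_in_y (R : realType) (n m : nat)
    (X : set 'rV[R]_n) (Y : set 'rV[R]_m)
    (f : 'rV[R]_n -> 'rV[R]_m -> R) (mu : R) : Prop :=
  forall x y y', X x -> Y y -> Y y' ->
    f x y' <= f x y + dot (grad_y f x y) (y' - y)
              - mu / 2 * enorm (y' - y) ^+ 2.

Definition lipschitz_gradients (R : realType) (n m : nat)
    (X : set 'rV[R]_n) (Y : set 'rV[R]_m)
    (f : 'rV[R]_n -> 'rV[R]_m -> R) (L11 L12 L22 : R) : Prop :=
  forall x x' y y', X x -> X x' -> Y y -> Y y' ->
    [/\ enorm (grad_x f x y - grad_x f x' y) <= L11 * enorm (x - x'),
        enorm (grad_y f x y - grad_y f x' y) <= L12 * enorm (x - x') &
        enorm (grad_y f x y' - grad_y f x y) <= L22 * enorm (y' - y)].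

(* The outer index i and the inner index k are both counted from 0: [l_ l1 0]
   is the input l_1, and [agp_iter ... i k] is the pair
   (x_{i+1,k+1}, y_{i+1,k+1}) of the sequence indexed from 1. *)
Definition l_ (R : realType) (l1 : R) (i : nat) : R :=
  iter i (fun l => 2 * l) l1.

Definition beta_ (R : realType) (l1 : R) (i : nat) : R := 3 * l_ l1 i.

Definition alpha_ (R : realType) (mu l1 : R) (i : nat) : R :=
  158 * l_ l1 i ^+ 3 / mu ^+ 2.

Definition agp_step (R : realType) (n m : nat)
    (X : set 'rV[R]_n) (Y : set 'rV[R]_m)
    (f : 'rV[R]_n -> 'rV[R]_m -> R) (alpha beta : R)
    (z : 'rV[R]_n * 'rV[R]_m) : 'rV[R]_n * 'rV[R]_m :=
  let y' := proj Y (z.2 + beta^-1 *: grad_y f z.1 z.2) in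
  let x' := proj X (z.1 - alpha^-1 *: grad_x f z.1 y') in
  (x', y').

(* Every outer index restarts from the same initial point. *)
Definition agp_iter (R : realType) (n m : nat)
    (X : set 'rV[R]_n) (Y : set 'rV[R]_m)
    (f : 'rV[R]_n -> 'rV[R]_m -> R) (mu l1 : R)
    (x1 : 'rV[R]_n) (y1 : 'rV[R]_m) (i k : nat) : 'rV[R]_n * 'rV[R]_m :=
  iter k (agp_step X Y f (alpha_ mu l1 i) (beta_ l1 i)) (x1, y1).

Definition gapG (R : realType) (n m : nat)
    (X : set 'rV[R]_n) (Y : set 'rV[R]_m)
    (f : 'rV[R]_n -> 'rV[R]_m -> R) (alpha beta : R)
    (z : 'rV[R]_n * 'rV[R]_m) : 'rV[R]_(n + m) :=
  row_mx
    (alpha *: (z.1 - proj X (z.1 - alpha^-1 *: grad_x f z.1 z.2)))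
    (beta *: (z.2 - proj Y (z.2 + beta^-1 *: grad_y f z.1 z.2))).

(* T = min {k | ||grad G|| <= eps} for the inner index k counted from 0, i.e.
   the number of inner iterations performed until the first eps-stationary
   point. Counting k from 1 would give T + 1, which cannot be bounded by
   d2 / (eps^2 d1): this bound is 0 when X and Y are singletons. *)
Definition is_T (R : realType) (n m : nat)
    (X : set 'rV[R]_n) (Y : set 'rV[R]_m)
    (f : 'rV[R]_n -> 'rV[R]_m -> R) (mu l1 : R)
    (x1 : 'rV[R]_n) (y1 : 'rV[R]_m) (i : nat) (eps : R) (T : nat) : Prop :=
  let gap k := enorm (gapG X Y f (alpha_ mu l1 i) (beta_ l1 i)
                        (agp_iter X Y f mu l1 x1 y1 i k)) in
  gap T <= eps /\ forall k, gap k <= eps -> (T <= k)%N.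

(* [sup] and [inf] are in fact max and min, attained for
   X and Y nonempty compact and f continuous on X x Y. *)
Definition Phi (R : realType) (n m : nat) (Y : set 'rV[R]_m)
    (f : 'rV[R]_n -> 'rV[R]_m -> R) (x : 'rV[R]_n) : R :=
  sup [set f x y | y in Y].

Definition pot (R : realType) (n m : nat) (Y : set 'rV[R]_m)
    (f : 'rV[R]_n -> 'rV[R]_m -> R) (x : 'rV[R]_n) (y : 'rV[R]_m) : R :=
  2 * Phi Y f x - f x y.

Definition S_low (R : realType) (n m : nat)
    (X : set 'rV[R]_n) (Y : set 'rV[R]_m)
    (f : 'rV[R]_n -> 'rV[R]_m -> R) : R :=
  inf [set Phi Y f x | x in X].

Definition eta_ (R : realType) (mu L beta : R) : R :=
  (2 * beta + mu) * (beta + L) / (mu * beta).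

Definition alpha_bound (R : realType) (mu L beta : R) : R :=
  L * (L + beta) ^+ 2 * eta_ mu L beta ^+ 2 / beta ^+ 2
  + L ^+ 2 / mu + 3 * L / 2.

Definition d1 (R : realType) (mu L alpha beta : R) : R :=
  Num.min ((alpha - alpha_bound mu L beta) / (2 * alpha ^+ 2))
          ((beta - 3 * L / 2) / (beta ^+ 2 + 2 * L ^+ 2)).

(* Main.v *)
(* With S = 2 Phi - f as potential, one iteration (x, y) -> (x', y') gives
     S(x, y) - S(x', y') >= (alpha - alpha_bound) |x' - x|^2
                            + (beta - 3 L / 2) |y' - y|^2,
   while the squared stationarity gap at (x, y) is at most
   2 alpha^2 |x' - x|^2 + (beta^2 + 2 L^2) |y' - y|^2. Hence each iteration
   before the first eps-stationary point lowers S by at least d1 eps^2, and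
   S >= S_low. The decrease of S combines the quadratic bounds on f, the
   estimate mu |y' - y*(x)| <= (L + beta) |y' - y| for the dual step,
   where y*(x) maximizes f(x, .), and
   the quadratic upper bound on Phi with curvature L + L^2 / mu, whose slope
   is grad_x f(x, y*(x)). That bound comes from quadratic growth
   f(x, y) <= Phi(x) - mu / 2 |y - y*(x)|^2, without differentiating Phi. *)
Require Import Defs.
From HB Require Import structures.
From mathcomp Require Import all_boot all_order all_algebra.
From mathcomp Require Import all_classical all_reals all_analysis.
From mathcomp Require Import ring lra.

Import Order.TTheory GRing.Theory Num.Theory.
Import numFieldNormedType.Exports.

Local Open Scope classical_set_scope.
Local Open Scope ring_scope.

Set Implicit Arguments.
Unset Strict Implicit.
Unset Printing Implicit Defensive.

(** * Euclidean inner product and norm on row vectors *)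

Section Euclidean.
Context {R : realType} {p : nat}.
Implicit Types (u v w : 'rV[R]_p) (k : R).

Lemma dotC u v : dot u v = dot v u.
Proof. by apply: eq_bigr => j _; rewrite mulrC. Qed.

Lemma dotDl u v w : dot (u + v) w = dot u w + dot v w.
Proof. by rewrite -big_split; apply: eq_bigr => j _; rewrite mxE mulrDl. Qed.

Lemma dotZl k u v : dot (k *: u) v = k * dot u v.
Proof. by rewrite big_distrr; apply: eq_bigr => j _; rewrite mxE /= mulrA. Qed.

Lemma dotNl u v : dot (- u) v = - dot u v.
Proof. by rewrite -scaleN1r dotZl mulN1r. Qed.

Lemma dotBl u v w : dot (u - v) w = dot u w - dot v w.
Proof. by rewrite dotDl dotNl. Qed.

Lemma dotDr u v w : dot u (v + w) = dot u v + dot u w.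
Proof. by rewrite dotC dotDl !(dotC u). Qed.

Lemma dotZr k u v : dot u (k *: v) = k * dot u v.
Proof. by rewrite dotC dotZl dotC. Qed.

Lemma dotNr u v : dot u (- v) = - dot u v.
Proof. by rewrite dotC dotNl dotC. Qed.

Lemma dotBr u v w : dot u (v - w) = dot u v - dot u w.
Proof. by rewrite dotDr dotNr. Qed.

Lemma dot_ge0 u : 0 <= dot u u.
Proof. by apply: sumr_ge0 => j _; rewrite -expr2 sqr_ge0. Qed.

Lemma enorm_ge0 u : 0 <= enorm u.
Proof. exact: sqrtr_ge0. Qed.

Lemma enorm_sqr u : enorm u ^+ 2 = dot u u.
Proof. exact/sqr_sqrtr/dot_ge0. Qed.

Lemma enormZ k u : 0 <= k -> enorm (k *: u) = k * enorm u.
Proof.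
move=> k0; rewrite /enorm dotZl dotZr mulrA -expr2 sqrtrM ?sqr_ge0//.
by rewrite sqrtr_sqr ger0_norm.
Qed.

Lemma enormN u : enorm (- u) = enorm u.
Proof. by rewrite /enorm dotNl dotNr opprK. Qed.

Lemma enormB u v : enorm (u - v) = enorm (v - u).
Proof. by rewrite -enormN opprB. Qed.

Lemma dot_subZ k u v :
  dot (u - k *: v) (u - k *: v) = dot u u - 2 * k * dot u v + k ^+ 2 * dot v v.
Proof. by rewrite dotBl !dotBr !dotZl !dotZr (dotC v u); ring. Qed.

Lemma dot_le_enorm u v : dot u v <= enorm u * enorm v.
Proof.
have [nu|nu] := leP (dot u v) 0.
  by rewrite (le_trans nu)// mulr_ge0// enorm_ge0.
have H : dot u v ^+ 2 <= dot u u * dot v v.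
  have := dot_ge0 (dot v v *: u - dot u v *: v).
  rewrite dotBl !dotBr !dotZl !dotZr (dotC v u).
  have v0 := dot_ge0 v.
  have [vv|vv _] := ltP 0 (dot v v); first by nra.
  have {}vv : dot v v = 0 by apply/le_anti/andP.
  (* Here [dot v v = 0], so the squared norm of [u - t v] is affine in [t]; this [t] makes it equal
     to -1, a contradiction. *)
  have := dot_ge0 (u - ((dot u u + 1) / (2 * dot u v)) *: v).
  rewrite dot_subZ vv.
  have -> : 2 * ((dot u u + 1) / (2 * dot u v)) * dot u v = dot u u + 1.
    by field; rewrite gt_eqF.
  lra.
rewrite -ler_sqr ?nnegrE ?(ltW nu) ?mulr_ge0 ?enorm_ge0//.
by rewrite exprMn !enorm_sqr.
Qed.

Lemma enormD u v : enorm (u + v) <= enorm u + enorm v.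
Proof.
rewrite -ler_sqr ?nnegrE ?addr_ge0 ?enorm_ge0// sqrrD !enorm_sqr.
by rewrite dotDl !dotDr (dotC v u); have := dot_le_enorm u v; lra.
Qed.

End Euclidean.

Lemma enorm_row_mx (R : realType) (p q : nat) (u : 'rV[R]_p) (v : 'rV[R]_q) :
  enorm (row_mx u v) ^+ 2 = enorm u ^+ 2 + enorm v ^+ 2.
Proof.
rewrite !enorm_sqr /dot big_split_ord; congr (_ + _).
  by apply: eq_bigr => j _; rewrite row_mxEl.
by apply: eq_bigr => j _; rewrite row_mxEr.
Qed.

(** Cancels a factor that may be zero; it is applied with [a] a scaled norm. *)
Lemma ler_of_sqr_le_mul (R : realType) (a b : R) : 0 <= b -> a ^+ 2 <= b * a -> a <= b.
Proof. by move=> b0 H; rewrite leNgt; apply/negP => ba; nra. Qed.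

(** * One-variable calculus and derivatives along lines *)

Section OneVariable.
Context {R : realType}.

(** Mean value theorem for [h] minus the primitive [a t + c t^2 / 2] of the bound. It stands in for
    integrating a gradient along a segment. *)
Lemma derive_le_increment (h dh : R -> R) (a c : R) :
  (forall t : R, 0 <= t <= 1 -> is_derive t (1 : R) h (dh t)) ->
  (forall t, 0 <= t <= 1 -> dh t <= a + c * t) ->
  h 1 <= h 0 + a + c / 2.
Proof.
move=> Hd Hle.
pose g := fun t : R => h t - (a * t + c / 2 * t ^+ 2).
pose dg := fun t : R => dh t - (a + c * t).
have Hg (t : R) : 0 <= t <= 1 -> is_derive t (1 : R) g (dg t).
  move=> /Hd Ht; apply: is_derive_eq.
  rewrite /dg; congr (_ - _); rewrite /GRing.scale /=.
  have E : a * 1 + c / 2 * (t * 1 + t * 1) = a + c * t by field.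
  exact: E.
have [t||t] := @MVT_segment R g dg 0 1 ler01.
- by rewrite in_itv /= => /andP[/ltW t0 /ltW t1]; apply: Hg; rewrite t0.
- apply: derivable_within_continuous => t.
  by rewrite in_itv => /Hg Ht; exact: ex_derive.
by rewrite in_itv => /Hle; rewrite /dg /g => + e; lra.
Qed.

Lemma derive_ge0_of_min (h : R -> R) (l : R) :
  is_derive (0 : R) (1 : R) h l -> (forall t, 0 <= t <= 1 -> h 0 <= h t) -> 0 <= l.
Proof.
move=> Hd Hmin; have [/cvg_ex[l' /= Hl]] := Hd.
rewrite /derive (cvg_lim _ Hl)// => <-.
(* The minimum is only over [0, 1], so the two-sided limit is restricted to [t > 0], where the
   difference quotients are nonnegative. *)
have Hr : (t^-1 *: ((h \o shift 0) (t *: 1) - h 0)) @[t --> (0:R)^'+] --> l'.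
  move=> P /Hl [e /= e0 He]; exists e => //= t te t0.
  by apply: He => //; rewrite gt_eqF.
rewrite -(cvg_lim _ Hr)//; apply: limr_ge; first by apply/cvg_ex; exists l'.
near=> t.
have t0 : 0 < t by near: t; exact: nbhs_right_gt.
have t1 : t < 1 by near: t; exact: nbhs_right_lt.
rewrite /GRing.scale /= addr0 mulr1 mulr_ge0 ?invr_ge0 ?(ltW t0)//.
by rewrite subr_ge0 Hmin// !ltW.
Unshelve. all: by end_near. Qed.

End OneVariable.

Lemma derive_along_line (R : realType) (p : nat) (g : 'rV[R]_p -> R) (u d : 'rV[R]_p)
    (t : R) :
  differentiable g (u + t *: d) ->
  is_derive t (1 : R) (fun s : R => g (u + s *: d)) (dot (grad g (u + t *: d)) d).
Proof.
move=> Hg.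
have Hl : is_diff t (fun s : R => u + s *: d) ( *:%R ^~ d).
  by apply: is_diff_eq; rewrite add0r.
pose l (s : R) := u + s *: d.
have Hd : differentiable (g \o l) t by apply: differentiable_comp.
rewrite -[fun s : R => _]/(g \o l).
apply: DeriveDef; first exact: diff_derivable.
rewrite deriveE// diff_comp// diff_val /= scale1r {1}(row_sum_delta d) linear_sum /=.
by apply: eq_bigr => j _; rewrite linearZ /= mxE deriveE// mulrC.
Qed.

(** * Projection onto a compact convex set *)

Section Projection.
Context {R : realType} {p : nat}.
Variables (C : set 'rV[R]_p).
Hypotheses (C_nonempty : C !=set0) (C_compact : compact C) (C_convex : convex_set C).
Implicit Types (u v w : 'rV[R]_p) (t : R).

Lemma convex_set_segment u v t : C u -> C v -> 0 <= t <= 1 -> C (u + t *: (v - u)).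
Proof.
move=> Cu Cv Ht.
pose k : {i01 R} := Itv01 (proj1 (andP Ht)) (proj2 (andP Ht)).
(* The library's convex combination puts the weight [k] on its first point, hence [v] before [u]. *)
have := C_convex k (mem_set Cv) (mem_set Cu); rewrite inE.
congr (C _); rewrite /conv /= /unstable.onem.
by rewrite scalerBl scalerBr scale1r addrCA.
Qed.

Lemma continuous_enormB u : continuous (fun c : 'rV[R]_p => enorm (u - c)).
Proof.
move=> c.
apply: (@continuous_comp _ _ _ (fun c : 'rV[R]_p => dot (u - c) (u - c)) Num.sqrt);
  last exact: sqrt_continuous.
apply: differentiable_continuous.
rewrite /dot.
have -> : (fun c : 'rV[R]_p => \sum_(j < p) (u - c) 0 j * (u - c) 0 j) =
    \sum_(j < p) (fun c : 'rV[R]_p => (u 0 j - c 0 j) * (u 0 j - c 0 j)).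
  by apply/funext => x; rewrite fct_sumE; apply: eq_bigr => j _; rewrite !mxE.
apply: differentiable_sum => j.
have Hj : differentiable (fun c : 'rV[R]_p => u 0 j - c 0 j) c.
  by apply: differentiableB; [exact: differentiable_cst|exact: differentiable_coord].
exact: differentiableM.
Qed.

Lemma proj_nearest u :
  C (Defs.proj C u) /\ forall c, C c -> enorm (u - Defs.proj C u) <= enorm (u - c).
Proof.
(* The default branch of [xget] is excluded because the distance to [u] attains its minimum on
   [C]. *)
rewrite /Defs.proj; case: xgetP => [c _ //|none].
have [|c Cc Hc] := @EVT_min_rV R p (fun c : 'rV[R]_p => enorm (u - c)) C
  C_nonempty C_compact.
  exact/continuous_subspaceT/continuous_enormB.
exfalso; apply: (none c); split; first exact: set_mem.
by move=> c' Cc'; apply: Hc; exact: mem_set.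
Qed.

Lemma proj_in u : C (Defs.proj C u).
Proof. by have [] := proj_nearest u. Qed.

Lemma proj_variational u c : C c -> dot (u - Defs.proj C u) (c - Defs.proj C u) <= 0.
Proof.
move=> Cc; have [Cp Hp] := proj_nearest u.
set q := Defs.proj C u in Cp Hp *; set a := u - q; set b := c - q.
rewrite leNgt; apply/negP => pos.
have DE : 0 < dot a b + dot b b by rewrite ltr_wpDr ?dot_ge0.
(* Moving from [q] towards [c] by [t] in (0, 1] cannot decrease the distance to [u], which forces
   [2 (a.b) <= t (b.b)]. This choice of [t] gives [t (b.b) = (1 - t) (a.b)], which is smaller than
   [a.b]. *)
pose t := dot a b / (dot a b + dot b b).
have tp : 0 < t by rewrite divr_gt0.
have t1 : t <= 1 by rewrite /t ler_pdivrMr// mul1r lerDl dot_ge0.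
have tD : t * (dot a b + dot b b) = dot a b by rewrite /t divfK// gt_eqF.
have := Hp _ (convex_set_segment Cp Cc (introT andP (conj (ltW tp) t1))).
rewrite -ler_sqr ?nnegrE ?enorm_ge0// !enorm_sqr.
have -> : u - (q + t *: (c - q)) = a - t *: b by rewrite opprD addrA.
rewrite dot_subZ => H.
have : 0 < t * dot a b by rewrite mulr_gt0.
have : 2 * dot a b <= t * dot b b by rewrite -(ler_pM2l tp); lra.
lra.
Qed.

Lemma proj_firmly_nonexpansive u v :
  enorm (Defs.proj C u - Defs.proj C v) ^+ 2
    <= dot (u - v) (Defs.proj C u - Defs.proj C v).
Proof.
have := proj_variational u (proj_in v); have := proj_variational v (proj_in u).
rewrite enorm_sqr; move: (Defs.proj C u) (Defs.proj C v) => p' q.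
by rewrite !dotBl !dotBr (dotC q p'); lra.
Qed.

(** Firm nonexpansiveness pairs [b - a] only with the difference of two projections, so a bound on
    [b - a] along directions joining points of [C] is enough; no bound on its norm is assumed. *)
Lemma proj_step_lipschitz (alpha K : R) u a b : 0 < alpha -> 0 <= K ->
  (forall v w, C v -> C w -> dot (b - a) (w - v) <= K * enorm (w - v)) ->
  alpha * enorm (Defs.proj C (u - alpha^-1 *: b) - Defs.proj C (u - alpha^-1 *: a))
    <= K.
Proof.
move=> a0 K0 Hab.
have := Hab _ _ (proj_in (u - alpha^-1 *: b)) (proj_in (u - alpha^-1 *: a)).
have := proj_firmly_nonexpansive (u - alpha^-1 *: b) (u - alpha^-1 *: a).
move: (Defs.proj C _) (Defs.proj C _) => v w.
have -> : u - alpha^-1 *: b - (u - alpha^-1 *: a) = - (alpha^-1 *: (b - a)).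
  by rewrite opprD addrACA subrr add0r -opprD -scalerBr.
rewrite dotNl dotZl -mulrN -dotNr opprB => H H'; move: H.
rewrite -(ler_pM2l a0) mulVKf ?gt_eqF// => /le_trans/(_ H').
rewrite (enormB w) -subr_ge0 => H; apply: ler_of_sqr_le_mul => //.
by rewrite -subr_ge0; have := mulr_ge0 (ltW a0) H; congr (0 <= _); ring.
Qed.

(** This is the variational inequality of the projection tested at the starting point [u], which
    lies in [C]. *)
Lemma proj_step_descent (alpha : R) u a : 0 < alpha -> C u ->
  dot a (Defs.proj C (u - alpha^-1 *: a) - u)
    <= - (alpha * enorm (Defs.proj C (u - alpha^-1 *: a) - u) ^+ 2).
Proof.
move=> a0 Cu; have := proj_variational (u - alpha^-1 *: a) Cu.
move: (Defs.proj C _) => v.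
rewrite addrAC -(opprB v u) dotNr dotBl dotNl dotZl enorm_sqr -(ler_pM2l a0) mulr0.
by rewrite mulrN mulrBr mulrN mulVKf ?gt_eqF//; lra.
Qed.

End Projection.

(** * First-order conditions and quadratic bounds on a convex set *)

Section LipschitzGradient.
Context {R : realType} {p : nat}.
Variables (C : set 'rV[R]_p) (g : 'rV[R]_p -> R).
Hypotheses (C_convex : convex_set C)
  (g_diff : forall u, C u -> differentiable g u).
Implicit Types (u v : 'rV[R]_p).

Lemma derive_segment u v (t : R) : C u -> C v -> 0 <= t <= 1 ->
  is_derive t (1 : R) (fun s : R => g (u + s *: (v - u)))
    (dot (grad g (u + t *: (v - u))) (v - u)).
Proof.
move=> Cu Cv Ht; apply: derive_along_line; apply: g_diff.
exact: convex_set_segment.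
Qed.

Lemma derive_segment0 u v : C u -> C v ->
  is_derive (0 : R) (1 : R) (fun s : R => g (u + s *: (v - u)))
    (dot (grad g u) (v - u)).
Proof.
move=> Cu Cv; have := derive_segment Cu Cv (introT andP (conj (lexx 0) ler01)).
by rewrite scale0r addr0.
Qed.

Lemma max_variational u v : C u -> C v -> (forall w, C w -> g w <= g u) ->
  dot (grad g u) (v - u) <= 0.
Proof.
move=> Cu Cv Hmax; rewrite -oppr_ge0.
apply: (@derive_ge0_of_min _ (fun s : R => - g (u + s *: (v - u)))).
  by have := derive_segment0 Cu Cv; exact: is_deriveN.
move=> t Ht; rewrite scale0r addr0 lerN2; apply: Hmax.
exact: convex_set_segment.
Qed.

Variable (K : R).
Hypothesis (g_lip : forall u v, C u -> C v ->
  enorm (grad g u - grad g v) <= K * enorm (u - v)).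

Lemma grad_segment_lip u v (t : R) : C u -> C v -> 0 <= t <= 1 ->
  enorm (grad g (u + t *: (v - u)) - grad g u) * enorm (v - u)
    <= K * enorm (v - u) ^+ 2 * t.
Proof.
move=> Cu Cv Ht.
have := g_lip (convex_set_segment C_convex Cu Cv Ht) Cu.
rewrite [u + _ - u]addrC addKr enormZ; last by case/andP: Ht.
move=> /(ler_wpM2r (enorm_ge0 (v - u))) /le_trans; apply.
have -> : K * (t * enorm (v - u)) * enorm (v - u) = K * enorm (v - u) ^+ 2 * t.
  ring.
exact: lexx.
Qed.

Lemma quadratic_upper_bound u v : C u -> C v ->
  g v <= g u + dot (grad g u) (v - u) + K / 2 * enorm (v - u) ^+ 2.
Proof.
move=> Cu Cv.
have := @derive_le_increment _ (fun s : R => g (u + s *: (v - u))) _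
  (dot (grad g u) (v - u)) (K * enorm (v - u) ^+ 2)
  (fun t => derive_segment Cu Cv).
rewrite scale0r addr0 scale1r [u + (v - u)]addrC subrK => H.
have : g v <= g u + dot (grad g u) (v - u) + K * enorm (v - u) ^+ 2 / 2.
  apply: H => t Ht; rewrite -lerBlDl -dotBl.
  exact: le_trans (dot_le_enorm _ _) (grad_segment_lip Cu Cv Ht).
lra.
Qed.

Lemma quadratic_lower_bound u v : C u -> C v ->
  g u + dot (grad g u) (v - u) - K / 2 * enorm (v - u) ^+ 2 <= g v.
Proof.
move=> Cu Cv.
have Hd (t : R) : 0 <= t <= 1 ->
    is_derive t (1 : R) (fun s : R => - g (u + s *: (v - u)))
      (- dot (grad g (u + t *: (v - u))) (v - u)).
  by move=> /(derive_segment Cu Cv) ?; exact: is_deriveN.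
have := derive_le_increment (a := - dot (grad g u) (v - u))
  (c := K * enorm (v - u) ^+ 2) Hd.
rewrite scale0r addr0 scale1r [u + (v - u)]addrC subrK => H.
have : - g v <= - g u - dot (grad g u) (v - u) + K * enorm (v - u) ^+ 2 / 2.
  apply: H => t Ht; rewrite -lerBlDl opprK addrC -dotBl.
  apply: le_trans (dot_le_enorm _ _) _; rewrite enormB.
  exact: grad_segment_lip.
lra.
Qed.

End LipschitzGradient.

(** * The minimax problem: cross-variation of gradients, inner maximum, effect of one iteration *)

Section Minimax.
Context {R : realType} {n m : nat}.
Variables (X : set 'rV[R]_n) (Y : set 'rV[R]_m) (f : 'rV[R]_n -> 'rV[R]_m -> R).
Variables (mu L : R).
Hypotheses (X_nonempty : X !=set0) (X_compact : compact X) (X_convex : convex_set X)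
  (Y_nonempty : Y !=set0) (Y_compact : compact Y) (Y_convex : convex_set Y)
  (f_diff : forall x y, X x -> Y y ->
     differentiable (fun z : 'rV[R]_n * 'rV[R]_m => f z.1 z.2) (x, y))
  (mu_gt0 : 0 < mu) (f_concave : strongly_concave_in_y X Y f mu)
  (L_gt0 : 0 < L) (f_lipschitz : lipschitz_gradients X Y f L L L).
Implicit Types (x p q : 'rV[R]_n) (y : 'rV[R]_m).

Lemma differentiable_x x y : X x -> Y y -> differentiable (f ^~ y) x.
Proof.
move=> Xx Yy.
apply: (@differentiable_comp _ _ _ _ (fun x' => (x', y))
  (fun z : 'rV[R]_n * 'rV[R]_m => f z.1 z.2)); last exact: f_diff.
by apply: differentiable_pair => //; exact: differentiable_cst.
Qed.

Lemma differentiable_y x y : X x -> Y y -> differentiable (f x) y.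
Proof.
move=> Xx Yy.
apply: (@differentiable_comp _ _ _ _ (fun y' => (x, y'))
  (fun z : 'rV[R]_n * 'rV[R]_m => f z.1 z.2)); last exact: f_diff.
by apply: differentiable_pair => //; exact: differentiable_cst.
Qed.

(** Along the segment from [y] to [y'], the derivative of [f q - f p] is a difference of [grad_y] at
    [q] and [p], which the Lipschitz bound of [grad_y] in [x] controls. *)
Lemma mixed_difference_le p q y y' : X p -> X q -> Y y -> Y y' ->
  f q y' - f q y - (f p y' - f p y) <= L * enorm (y' - y) * enorm (q - p).
Proof.
move=> Xp Xq Yy Yy'.
pose h x (s : R) := f x (y + s *: (y' - y)).
pose dh x (s : R) := dot (grad_y f x (y + s *: (y' - y))) (y' - y).
have Hh x (t : R) : X x -> 0 <= t <= 1 -> is_derive t (1 : R) (h x) (dh x t).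
  by move=> Xx; apply: (@derive_segment _ _ Y (f x)) => // u; exact: differentiable_y.
have := @derive_le_increment _ (h q - h p) (dh q - dh p)
  (L * enorm (y' - y) * enorm (q - p)) 0.
rewrite /h !fctE !scale0r !addr0 !scale1r ![y + (y' - y)]addrC !subrK mul0r addr0.
move=> H; have {}H : f q y' - f p y' <= f q y - f p y + L * enorm (y' - y) * enorm (q - p).
  apply: H => t Ht; first by apply: is_deriveB; exact: Hh.
  rewrite mul0r addr0 /dh -dotBl (le_trans (dot_le_enorm _ _))//.
  have [_ + _] := f_lipschitz Xq Xp (convex_set_segment Y_convex Yy Yy' Ht) Yy.
  by move=> /(ler_wpM2r (enorm_ge0 (y' - y))); rewrite mulrAC.
lra.
Qed.

(* The hypotheses do not bound the variation of [grad_x f x y] in [y] itself: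
   only its components along directions joining two points of [X] are
   controlled, through the symmetry of the mixed difference quotient. *)
Lemma grad_x_lipschitz_y x p q y y' : X x -> X p -> X q -> Y y -> Y y' ->
  dot (grad_x f x y' - grad_x f x y) (q - p) <= L * enorm (y' - y) * enorm (q - p).
Proof.
move=> Xx Xp Xq Yy Yy'; rewrite -subr_ge0.
set K := L * _ * _.
pose D w (s : R) := f (x + s *: (w - x)) y' - f (x + s *: (w - x)) y.
have HD w : X w -> is_derive (0 : R) (1 : R) (D w)
    (dot (grad_x f x y' - grad_x f x y) (w - x)).
  move=> Xw; rewrite dotBl; apply: is_deriveB.
    by apply: (@derive_segment0 _ _ X (f ^~ y')) => // u Xu; exact: differentiable_x.
  by apply: (@derive_segment0 _ _ X (f ^~ y)) => // u Xu; exact: differentiable_x.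
(* [D q s - D p s] is a mixed difference between points at distance [s |q - p|], hence at most
   [K s]. So this function is minimal at 0, and the sign of its derivative there is the claim. *)
apply: (@derive_ge0_of_min _ (fun s : R => K * s - (D q s - D p s))
  (K - dot (grad_x f x y' - grad_x f x y) (q - p))).
  have -> : q - p = (q - x) - (p - x) by rewrite opprB addrA subrK.
  rewrite dotBr; apply: is_deriveB; last by apply: is_deriveB; exact: HD.
  by apply: is_derive_eq; rewrite /GRing.scale /= mulr1.
move=> t Ht.
rewrite {1 2}/D !scale0r !addr0 mulr0 !subrr subr_ge0.
have Xs w : X w -> X (x + t *: (w - x)) by move=> Xw; exact: convex_set_segment.
apply: le_trans (mixed_difference_le (Xs _ Xp) (Xs _ Xq) Yy Yy') _.
rewrite opprD addrACA subrr add0r -scalerBr opprB addrA subrK.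
by rewrite enormZ; [rewrite mulrCA mulrC|case/andP: Ht].
Qed.

Lemma proj_x_lipschitz_y (alpha : R) x y y' : 0 < alpha -> X x -> Y y -> Y y' ->
  alpha * enorm (Defs.proj X (x - alpha^-1 *: grad_x f x y')
                 - Defs.proj X (x - alpha^-1 *: grad_x f x y))
    <= L * enorm (y' - y).
Proof.
move=> a0 Xx Yy Yy'.
apply: proj_step_lipschitz => //; first by rewrite mulr_ge0 ?(ltW L_gt0) ?enorm_ge0.
by move=> p q Xp Xq; exact: grad_x_lipschitz_y.
Qed.

(** At the maximizer, the first-order condition makes the linear term of strong concavity
    nonpositive. *)
Lemma argmax_quadratic_growth x : X x -> exists2 ys, Y ys &
  Phi Y f x = f x ys /\ forall y, Y y -> f x y <= f x ys - mu / 2 * enorm (y - ys) ^+ 2.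
Proof.
move=> Xx.
have [|ys /set_mem Yys ysmax] := @EVT_max_rV R m (f x) Y Y_nonempty Y_compact.
  apply: continuous_in_subspaceT => y /set_mem Yy.
  exact/differentiable_continuous/differentiable_y.
have {}ysmax y : Y y -> f x y <= f x ys by move=> Yy; exact/ysmax/mem_set.
exists ys => //; split.
  apply/le_anti/andP; split.
    by apply: ge_sup; [exists (f x ys), ys|move=> _ [y Yy <-]; exact: ysmax].
  apply: ub_le_sup; last by exists ys.
  by exists (f x ys) => _ [y Yy <-]; exact: ysmax.
move=> y Yy; apply: le_trans (f_concave Xx Yys Yy) _.
have := @max_variational _ _ Y (f x) Y_convex
  (fun y' => differentiable_y Xx (y := y')) ys y Yys Yy ysmax.
by rewrite -/(grad_y f x ys); lra.
Qed.

(** Adding growth around [ys] to strong concavity at the new point [yp] bounds [mu |yp - ys|^2] by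
    the slope at [yp] towards [ys]. Replacing the gradient at [yp] by that at [y] costs the [L]
    term; the variational inequality of the projection gives the [beta] term. *)
Lemma dual_step_error (beta : R) x y ys : 0 < beta -> X x -> Y y -> Y ys ->
  (forall y', Y y' -> f x y' <= f x ys - mu / 2 * enorm (y' - ys) ^+ 2) ->
  mu * enorm (Defs.proj Y (y + beta^-1 *: grad_y f x y) - ys)
    <= (L + beta) * enorm (Defs.proj Y (y + beta^-1 *: grad_y f x y) - y).
Proof.
move=> b0 Xx Yy Yys growth.
have Yp := proj_in Y_nonempty Y_compact (y + beta^-1 *: grad_y f x y).
have := proj_variational Y_nonempty Y_compact Y_convex
  (y + beta^-1 *: grad_y f x y) Yys.
move: (Defs.proj Y _) Yp => yp Yp.
have [_ _] := f_lipschitz Xx Xx Yy Yp.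
have := growth _ Yp; have := f_concave Xx Yp Yys.
move: (grad_y f x y) (grad_y f x yp) => g gp.
rewrite (enormB ys) => H1 H2 lip var.
have {H1 H2}mono : mu * enorm (yp - ys) ^+ 2 <= dot gp (ys - yp) by lra.
have gap : dot (gp - g) (ys - yp) <= L * enorm (yp - y) * enorm (yp - ys).
  apply: le_trans (dot_le_enorm _ _) _; rewrite (enormB ys).
  by rewrite ler_wpM2r ?enorm_ge0.
have step : dot g (ys - yp) <= beta * (enorm (yp - y) * enorm (yp - ys)).
  have : beta * dot (yp - y) (ys - yp) <= beta * (enorm (yp - y) * enorm (yp - ys)).
    by rewrite ler_pM2l// (enormB yp ys) dot_le_enorm.
  apply: le_trans; move: var; rewrite -(ler_pM2l b0) mulr0 -!dotZl.
  have -> : beta *: (y + beta^-1 *: g - yp) = g - beta *: (yp - y).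
    rewrite scalerBr scalerDr scalerA divff ?gt_eqF// scale1r scalerBr.
    by rewrite opprB addrA (addrC g).
  by rewrite dotBl subr_le0.
have b1 : 0 <= (L + beta) * enorm (yp - y).
  by rewrite mulr_ge0 ?enorm_ge0// addr_ge0 ?(ltW L_gt0) ?ltW.
apply: ler_of_sqr_le_mul => //.
have : mu * enorm (yp - ys) ^+ 2 <= (L + beta) * enorm (yp - y) * enorm (yp - ys).
  apply: le_trans mono _; rewrite dotBl in gap; lra.
rewrite -(ler_pM2l mu_gt0) => H.
rewrite -subr_ge0; move: H; rewrite -subr_ge0; congr (0 <= _); ring.
Qed.

(** Expand [f] in [x] at the maximizer [ys'] for [x']. Moving the slope from [ys'] to [ys] costs
    [L e d], with [e = |ys' - ys|] and [d = |x' - x|]. Completing the square, the growth term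
    [- mu / 2 e^2] absorbs this up to [L^2 / (2 mu) d^2]. *)
Lemma Phi_descent x x' ys : X x -> X x' -> Y ys -> Phi Y f x = f x ys ->
  (forall y, Y y -> f x y <= f x ys - mu / 2 * enorm (y - ys) ^+ 2) ->
  Phi Y f x' <= Phi Y f x + dot (grad_x f x ys) (x' - x)
                + (L + L ^+ 2 / mu) / 2 * enorm (x' - x) ^+ 2.
Proof.
move=> Xx Xx' Yys -> growth.
have [ys' Yys' [-> _]] := argmax_quadratic_growth Xx'.
have := @quadratic_upper_bound _ _ X (f ^~ ys') X_convex
  (fun u Xu => differentiable_x Xu Yys') L _ x x' Xx Xx'.
move=> /(_ _)/wrap[u v Xu Xv|].
  by have [] := f_lipschitz Xu Xv Yys' Yys'.
have := grad_x_lipschitz_y Xx Xx Xx' Yys Yys'.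
have := growth _ Yys'.
rewrite -/(grad_x f x ys').
move: (grad_x f x ys) (grad_x f x ys') => g g'.
rewrite dotBl.
move: (enorm_ge0 (ys' - ys)) (enorm_ge0 (x' - x)).
move: (enorm (ys' - ys)) (enorm (x' - x)) => e d e0 d0 H1 H2 H3.
have : L * e * d <= mu / 2 * e ^+ 2 + L ^+ 2 / mu / 2 * d ^+ 2.
  rewrite -subr_ge0.
  have -> : mu / 2 * e ^+ 2 + L ^+ 2 / mu / 2 * d ^+ 2 - L * e * d =
      (mu * e - L * d) ^+ 2 / (2 * mu) by field; rewrite gt_eqF.
  by rewrite mulr_ge0 ?sqr_ge0// invr_ge0 mulr_ge0// ltW.
by rewrite mulrDl; lra.
Qed.

Lemma potential_decrease (alpha beta : R) x y : 0 < alpha -> 0 < beta -> X x -> Y y ->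
  let z := agp_step X Y f alpha beta (x, y) in
  (alpha - alpha_bound mu L beta) * enorm (z.1 - x) ^+ 2
    + (beta - 3 * L / 2) * enorm (z.2 - y) ^+ 2
  <= pot Y f x y - pot Y f z.1 z.2.
Proof.
move=> a0 b0 Xx Yy; rewrite /agp_step /=.
have [ys Yys [Phix growth]] := argmax_quadratic_growth Xx.
have err := dual_step_error b0 Xx Yy Yys growth.
have Yp := proj_in Y_nonempty Y_compact (y + beta^-1 *: grad_y f x y).
have stepy := proj_step_descent Y_nonempty Y_compact Y_convex (- grad_y f x y) b0 Yy.
rewrite scalerN opprK dotNl in stepy.
move: (Defs.proj Y _) err Yp stepy => yp err Yp stepy.
have Xp := proj_in X_nonempty X_compact (x - alpha^-1 *: grad_x f x yp).
have stepx := proj_step_descent X_nonempty X_compact X_convex (grad_x f x yp) a0 Xx.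
move: (Defs.proj X _) Xp stepx => xp Xp stepx.
have PhiD := Phi_descent Xx Xp Yys Phix growth.
have cross := grad_x_lipschitz_y Xx Xx Xp Yp Yys.
have lowx : f x yp + dot (grad_x f x yp) (xp - x) - L / 2 * enorm (xp - x) ^+ 2 <= f xp yp.
  apply: (@quadratic_lower_bound _ _ X (f ^~ yp)) => // [u Xu|u v Xu Xv].
    exact: differentiable_x.
  by have [] := f_lipschitz Xu Xv Yp Yp.
have lowy : f x y + dot (grad_y f x y) (yp - y) - L / 2 * enorm (yp - y) ^+ 2 <= f x yp.
  apply: (@quadratic_lower_bound _ _ Y (f x)) => // [u Yu|u v Yu Yv].
    exact: differentiable_y.
  by have [] := f_lipschitz Xx Xx Yv Yu.
move: PhiD cross lowx lowy stepx stepy; rewrite /pot.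
move: (grad_x f x ys) (grad_x f x yp) (grad_y f x y) => gs gp g.
rewrite dotBl (enormB ys yp).
move: err (enorm_ge0 (yp - ys)) (enorm_ge0 (yp - y)) (enorm_ge0 (xp - x)).
move: (enorm (yp - ys)) (enorm (yp - y)) (enorm (xp - x)) => e dy dx err e0 dy0 dx0.
move=> PhiD cross lowx lowy stepx stepy.
pose c := (L + beta) / mu.
have {}err : e <= c * dy by rewrite /c mulrAC ler_pdivlMr// mulrC.
(* The potential contains [2 Phi], so replacing the slope at [ys] by the one at [yp] costs
   [2 L e dx]. The share [L dy^2] joins the [L / 2] of [lowy] to give [3 L / 2]. *)
have young : 2 * L * e * dx <= L * dy ^+ 2 + L * c ^+ 2 * dx ^+ 2.
  have : L * e * dx <= L * (c * dy) * dx by rewrite ler_wpM2r// ler_pM2l.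
  have : 0 <= L * (dy - c * dx) ^+ 2 by rewrite mulr_ge0 ?sqr_ge0 ?ltW.
  by nra.
(* The estimates above produce [c = (L + beta) / mu], where [alpha_bound] has
   [(L + beta) eta / beta]; this inequality compares the two. *)
have eta_ge : mu^-1 <= eta_ mu L beta / beta.
  rewrite /eta_.
  have -> : (2 * beta + mu) * (beta + L) / (mu * beta) / beta =
      mu^-1 * (((2 * beta + mu) * (beta + L)) / beta ^+ 2).
    by field; rewrite !gt_eqF.
  rewrite ler_peMr ?invr_ge0 ?(ltW mu_gt0)// ler_pdivlMr ?exprn_gt0// mul1r.
  have ? := mulr_gt0 mu_gt0 b0; have ? := mulr_gt0 mu_gt0 L_gt0.
  by have ? := mulr_gt0 b0 L_gt0; nra.
have bound : L * c ^+ 2 + L ^+ 2 / mu + 3 * L / 2 <= alpha_bound mu L beta.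
  have Lb : 0 <= L + beta by rewrite addr_ge0 ?ltW.
  rewrite /alpha_bound !lerD2r.
  have -> : L * (L + beta) ^+ 2 * eta_ mu L beta ^+ 2 / beta ^+ 2 =
      L * ((L + beta) * (eta_ mu L beta / beta)) ^+ 2.
    by field; rewrite gt_eqF.
  have mV0 : 0 <= mu^-1 by rewrite invr_ge0 ltW.
  rewrite ler_pM2l// lerXn2r ?nnegrE ?(mulr_ge0 Lb)//; last exact: ler_wpM2l.
  exact: le_trans eta_ge.
have : (L * c ^+ 2 + L ^+ 2 / mu + 3 * L / 2) * dx ^+ 2 <= alpha_bound mu L beta * dx ^+ 2.
  by rewrite ler_wpM2r ?sqr_ge0.
move: (alpha_bound mu L beta) (L ^+ 2 / mu) bound PhiD => A B bound PhiD Hdx.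
lra.
Qed.

(** The dual block of the gap is exactly [beta (y - yp)]. The primal block uses the gradient at [y]
    whereas the iteration uses it at [yp]; the two projections differ by at most
    [L |yp - y| / alpha], and [(a + b)^2 <= 2 a^2 + 2 b^2] gives the factors 2. *)
Lemma gap_le (alpha beta : R) x y : 0 < alpha -> 0 < beta -> X x -> Y y ->
  let z := agp_step X Y f alpha beta (x, y) in
  enorm (gapG X Y f alpha beta (x, y)) ^+ 2
    <= 2 * alpha ^+ 2 * enorm (z.1 - x) ^+ 2
       + (beta ^+ 2 + 2 * L ^+ 2) * enorm (z.2 - y) ^+ 2.
Proof.
move=> a0 b0 Xx Yy; rewrite /agp_step /gapG /= enorm_row_mx !enormZ ?(ltW a0) ?(ltW b0)//.
have Yp := proj_in Y_nonempty Y_compact (y + beta^-1 *: grad_y f x y).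
move: (Defs.proj Y _) Yp => yp Yp; rewrite (enormB y).
have tri (u v w : 'rV[R]_n) : alpha * enorm (v - w) <= L * enorm (yp - y) ->
    (alpha * enorm (u - w)) ^+ 2
      <= 2 * alpha ^+ 2 * enorm (v - u) ^+ 2 + 2 * L ^+ 2 * enorm (yp - y) ^+ 2.
  have := enormD (u - v) (v - w).
  rewrite addrA subrK (enormB u v) -(ler_pM2l a0) mulrDr.
  have := mulr_ge0 (ltW a0) (enorm_ge0 (u - w)).
  move: (alpha * enorm (u - w)) (enorm (v - w)) (enorm (v - u)) (enorm (yp - y)).
  move=> r s dx dy r0 rs sd.
  have : r ^+ 2 <= (alpha * dx + L * dy) ^+ 2.
    have rle : r <= alpha * dx + L * dy by lra.
    by rewrite ler_sqr ?nnegrE// (le_trans r0).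
  have := sqr_ge0 (alpha * dx - L * dy).
  by rewrite sqrrB sqrrD !exprMn; lra.
have := tri x _ _ (proj_x_lipschitz_y a0 Xx Yy Yp).
move: (alpha * _) (enorm (_ - x)) (enorm (yp - y)) => r dx dy.
by rewrite exprMn; lra.
Qed.

(** The potential is [Phi + (Phi - f)], and the second summand is nonnegative. *)
Lemma S_low_le_pot x y : X x -> Y y -> S_low X Y f <= pot Y f x y.
Proof.
move=> Xx Yy.
have le_Phi x' y' : X x' -> Y y' -> f x' y' <= Phi Y f x'.
  move=> Xx' Yy'; have [ys _ [-> /(_ _ Yy')]] := argmax_quadratic_growth Xx'.
  move/le_trans; apply; rewrite gerBl mulr_ge0 ?sqr_ge0//.
  by rewrite divr_ge0 ?ltW.
have : S_low X Y f <= Phi Y f x.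
  apply: ge_inf; last by exists x.
  (* The infimum needs a lower bound on the values of [Phi]: the minimum over [X] of [f] at the
     fixed [y] is one. *)
  have [|x0 /set_mem Xx0 Hx0] := @EVT_min_rV R n (f ^~ y) X X_nonempty X_compact.
    apply: continuous_in_subspaceT => u /set_mem Xu.
    exact/differentiable_continuous/differentiable_x.
  exists (f x0 y) => _ [u Xu <-]; apply: le_trans (le_Phi _ _ Xu Yy).
  exact/Hx0/mem_set.
by have := le_Phi _ _ Xx Yy; rewrite /pot; lra.
Qed.

End Minimax.

(** * From the decrease per iteration to the iteration count *)

Lemma lipschitz_gradientsW (R : realType) (n m : nat) (X : set 'rV[R]_n)
    (Y : set 'rV[R]_m) (f : 'rV[R]_n -> 'rV[R]_m -> R) (L11 L12 L22 L : R) :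
  L11 <= L -> L12 <= L -> L22 <= L ->
  lipschitz_gradients X Y f L11 L12 L22 -> lipschitz_gradients X Y f L L L.
Proof.
move=> l1 l2 l3 H x x' y y' Xx Xx' Yy Yy'.
have [H1 H2 H3] := H _ _ _ _ Xx Xx' Yy Yy'.
by split; [move: H1|move: H2|move: H3] => /le_trans; apply;
  rewrite ler_wpM2r ?enorm_ge0.
Qed.

Lemma l__gt0 (R : realType) (l1 : R) (i : nat) : 0 < l1 -> 0 < l_ l1 i.
Proof. by move=> l0; elim: i => //= i IH; rewrite mulr_gt0. Qed.

(** While the gap exceeds [eps], each step lowers [S] by at least [eps^2 d]. Telescoping bounds the
    number of such steps, which yields both the existence of a hit and the bound on the first
    one. *)
Lemma exists_first_hit (R : realType) (gap S : nat -> R) (d c eps : R) :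
  0 < d -> 0 < eps -> (forall k, c <= S k) ->
  (forall k, d * gap k ^+ 2 <= S k - S k.+1) ->
  exists T : nat, (gap T <= eps /\ forall k, gap k <= eps -> (T <= k)%N) /\
    T%:R <= (S 0%N - c) / (eps ^+ 2 * d).
Proof.
move=> d0 e0 Sc dec.
have ed : 0 < eps ^+ 2 * d by rewrite mulr_gt0 ?exprn_gt0.
have sum N : (forall k, (k < N)%N -> eps < gap k) ->
    N%:R * (eps ^+ 2 * d) <= S 0%N - S N.
  elim: N => [|N IH] H; first by rewrite mul0r subrr.
  have gN : eps ^+ 2 <= gap N ^+ 2.
    by rewrite lerXn2r ?nnegrE ?ltW// ?(lt_trans e0)// H.
  have := IH (fun k kN => H k (ltnW kN)); have := dec N.
  have : d * eps ^+ 2 <= d * gap N ^+ 2 by rewrite ler_pM2l.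
  by rewrite -natr1; lra.
have bound N : (forall k, (k < N)%N -> eps < gap k) ->
    N%:R <= (S 0%N - c) / (eps ^+ 2 * d).
  by move=> /sum HN; rewrite ler_pdivlMr//; have := Sc N; lra.
have ex : exists k, gap k <= eps.
  apply: contrapT => /forallNP none.
  have b0 : 0 <= (S 0%N - c) / (eps ^+ 2 * d) by have := bound 0%N; apply.
  have := archi_boundP b0; rewrite ltNge bound// => k _.
  by rewrite ltNge; exact/negP/none.
case: (ex_minnP ex) => T HT Tmin; exists T; do 2?split=> //.
(* By minimality the [T] indices below [T] all have gap above [eps], so exactly [T] decreases are
   counted. *)
apply: bound => k kT; rewrite ltNge; apply/negP => /Tmin.
by rewrite leqNgt kT.
Qed.

Unset Implicit Arguments.

Theorem theorem1 (R : realType) (n m : nat)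
    (X : set 'rV[R]_n) (Y : set 'rV[R]_m)
    (f : 'rV[R]_n -> 'rV[R]_m -> R)
    (mu L11 L12 L22 l1 : R) (x1 : 'rV[R]_n) (y1 : 'rV[R]_m)
    (X_nonempty : X !=set0) (X_compact : compact X)
    (X_convex : convex_set X)
    (Y_nonempty : Y !=set0) (Y_compact : compact Y)
    (Y_convex : convex_set Y)
    (f_smooth : smooth_on X Y f)
    (mu_gt0 : 0 < mu) (f_concave : strongly_concave_in_y X Y f mu)
    (L11_gt0 : 0 < L11) (L12_gt0 : 0 < L12) (L22_gt0 : 0 < L22)
    (f_lipschitz : lipschitz_gradients X Y f L11 L12 L22)
    (x1_in : X x1) (y1_in : Y y1) (l1_gt0 : 0 < l1) (i : nat) :
  let L := Num.max L11 (Num.max L12 L22) in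
  let alpha := alpha_ mu l1 i in
  let beta := beta_ l1 i in
  let d2 := pot Y f x1 y1 - S_low X Y f in
  3 * L / 2 < beta ->
  alpha_bound mu L beta < alpha ->
  forall eps : R, 0 < eps ->
    exists T : nat,
      is_T X Y f mu l1 x1 y1 i eps T /\
      T%:R <= d2 / (eps ^+ 2 * d1 mu L alpha beta).
Proof.
move=> L alpha beta d2 hbeta halpha eps eps_gt0.
have L_gt0 : 0 < L by rewrite /L lt_max L11_gt0.
have lipL : lipschitz_gradients X Y f L L L.
  by apply: lipschitz_gradientsW f_lipschitz; rewrite /L !le_max lexx ?orbT.
have [f_diff _ _] := f_smooth.
have li := l__gt0 i l1_gt0.
have b0 : 0 < beta by rewrite mulr_gt0.
have a0 : 0 < alpha by rewrite divr_gt0 ?mulr_gt0 ?exprn_gt0.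
pose z := agp_iter X Y f mu l1 x1 y1 i.
have zS k : z k.+1 = agp_step X Y f alpha beta (z k) by [].
have inXY k : X (z k).1 /\ Y (z k).2.
  elim: k => [|k _] //; rewrite zS; split; exact: proj_in.
have B0 : 0 < beta ^+ 2 + 2 * L ^+ 2 by rewrite addr_gt0 ?mulr_gt0 ?exprn_gt0.
have A0 : 0 < 2 * alpha ^+ 2 by rewrite mulr_gt0 ?exprn_gt0.
apply: (@exists_first_hit R
  (fun k => enorm (gapG X Y f alpha beta (z k)))
  (fun k => pot Y f (z k).1 (z k).2) (d1 mu L alpha beta) (S_low X Y f)) => //.
- by rewrite /d1 lt_min !divr_gt0 ?subr_gt0.
- by move=> k; have [Xk Yk] := inXY k; apply: (S_low_le_pot (mu := mu)).
move=> k; have [Xk Yk] := inXY k; rewrite zS.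
case: (z k) Xk Yk => x y Xx Yy.
have := potential_decrease X_nonempty X_compact X_convex Y_nonempty Y_compact Y_convex
  f_diff mu_gt0 f_concave L_gt0 lipL a0 b0 Xx Yy.
have := gap_le X_nonempty X_compact X_convex Y_nonempty Y_compact Y_convex
  f_diff L_gt0 lipL a0 b0 Xx Yy.
move: (agp_step _ _ _ _ _ _) => [x' y'] /= gap pot_dec.
apply: le_trans pot_dec.
have d0 : 0 < d1 mu L alpha beta by rewrite /d1 lt_min !divr_gt0 ?subr_gt0.
(* Each argument of the minimum in [d1] is a coefficient of the decrease over the matching
   coefficient of the gap bound, so [d1] times the gap bound is dominated term by term. *)
have dA : d1 mu L alpha beta * (2 * alpha ^+ 2) <= alpha - alpha_bound mu L beta.
  by rewrite -ler_pdivlMr// /d1 ge_min lexx.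
have dB : d1 mu L alpha beta * (beta ^+ 2 + 2 * L ^+ 2) <= beta - 3 * L / 2.
  by rewrite -ler_pdivlMr// /d1 ge_min lexx orbT.
apply: le_trans (ler_wpM2l (ltW d0) gap) _.
by rewrite mulrDr; apply: lerD; rewrite mulrA ler_wpM2r ?sqr_ge0.
Qed.
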